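(* Let $\delta>0$ and $x\in\mathcal{X}\setminus\widetilde{\mathcal{X}}_\delta$. Perform $K$ iterations of the cubic-regularized Newton method on the lower-level problem $g(x,\cdot)$, started at $y_0$, with regularization parameter $M=\overline{\overline L}_g$. Then the generated sequence $\{y_k\}_{k=1}^K$ converges to a local minimizer $y^{\mathrm{cd}}(x)$ of $g(x,\cdot)$ as $K\to\infty$. Let $\rho>0$. If $$K>K_1+K_2,$$ where $$K_1:=\max\left\{\frac{256(\overline g_0-\underline g)\big(\overline{\overline L}_g\big)^{1/2}}{9\Big(\min\Big\{\alpha\big(\delta,\tfrac{\mu(\delta)}{2\overline{\overline L}_g}\big),\tfrac{(\mu(\delta))^2}{4\overline{\overline L}_g}\Big\}\Big)^{3/2}},\ \frac{768(\overline g_0-\underline g)\overline{\overline L}_g^{\,2}}{(\mu(\delta))^3}\right\},\qquad K_2:=\frac{256(\overline g_0-\underline g)\big(\overline{\overline L}_g\big)^{1/2}}{9\big(\tfrac{\mu(\delta)\rho}{2}\big)^{3/2}},$$ then $$\min_{k=K_1+1,\dots,K}\|\nabla_yg(x,y_k)\|\le\mu(\delta)\rho,$$ and, with $\hat y(x):=y_{k_0}$, $k_0=\arg\min_{k=K_1+1,\dots,K}\|\nabla_yg(x,y_k)\|$, one also has $$\|\hat y(x)-y^{\mathrm{cd}}(x)\|\le\rho .$$ (Here $k=K_1+1,\dots,K$ denotes the integers $k$ with $K_1<k\le K$.)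
   Context: Data: $\mathcal{X}\subseteq\mathbb{R}^n$, real-valued functions $f(x,y)$ and $g(x,y)$ for $x\in\mathcal{X}$, $y\in\mathbb{R}^m$, and a fixed initial point $y_0$. Regularity assumptions: (1) $f$ is continuous and $g$ is twice continuously differentiable on $\mathcal{X}\times\mathbb{R}^m$; (2) $\mathcal{X}$ is convex and compact; (3) $g$ is Lipschitz smooth (has Lipschitz gradient) with constant $\overline L_g$ on $\mathcal{X}\times\mathbb{R}^m$; (4) $\nabla^2_{yy}g$ is Lipschitz continuous with constant $\overline{\overline L}_g$ on $\mathcal{X}\times\mathbb{R}^m$; (5) $g\ge\underline g$ on $\mathcal{X}\times\mathbb{R}^m$; (6) for every $x\in\mathcal{X}$ the sublevel set $\{y:g(x,y)\le g(x,y_0)\}$ is compact and contained in a compact set $\mathcal{Y}\subset\mathbb{R}^m$ independent of $x$; (7) $f$ is Lipschitz continuous with constant $L_f$ on $\{(x,y):x\in\mathcal{X},\ g(x,y)\le g(x,y_0)\}$. $\overline g_0$ is a constant with $g(x,y_0)\le\overline g_0$ for all $x\in\mathcal{X}$. $\widetilde{\mathcal{X}}:=\{x\in\mathcal{X}:g(x,\cdot)\text{ is not Morse}\}$, where $g(x,\cdot)$ is Morse if $\nabla_yg(x,y)=0$ implies $\det\nabla^2_{yy}g(x,y)\ne0$; $\widetilde{\mathcal{X}}_\delta:=\{x\in\mathcal{X}:\mathrm{dist}(x,\widetilde{\mathcal{X}})\le\delta\}$. Fix a compact set $\mathcal{Y}'$ with $\mathcal{Y}\subset\mathrm{int}(\mathcal{Y}')$.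 $\mu(\delta)>0$ is a function such that for every $x\in\mathcal{X}\setminus\widetilde{\mathcal{X}}_\delta$ and every stationary point $y\in\mathcal{Y}'$ of $g(x,\cdot)$, all eigenvalues $\lambda$ of $\nabla^2_{yy}g(x,y)$ satisfy $|\lambda|\ge\mu(\delta)$. With $\mathrm{Crit}(x):=\{y\in\mathcal{Y}':\nabla_yg(x,y)=0\}$ and $\mathrm{Crit}_r(x):=\{y\in\mathbb{R}^m:\mathrm{dist}(y,\mathrm{Crit}(x))\le r\}$, $\alpha(\delta,r)>0$ is a function such that $\|\nabla_yg(x,y)\|\ge\alpha(\delta,r)$ for all $x\in\mathcal{X}\setminus\widetilde{\mathcal{X}}_\delta$ and all $y\in\mathcal{Y}\setminus\mathrm{Crit}_r(x)$. Cubic-regularized Newton method with parameter $M$ on $g(x,\cdot)$: from $y_k$, let $s_k$ be a global minimizer over $s\in\mathbb{R}^m$ of $\nabla_yg(x,y_k)^\top s+\frac12 s^\top\nabla^2_{yy}g(x,y_k)s+\frac M6\|s\|^3$, and set $y_{k+1}=y_k+s_k$. The paper's standing assumption on the lower-level method is that there is an integer $K_0$ such that $g(x,y_k)\le g(x,y_0)$ for all $x\in\mathcal{X}$ and $k\ge K_0$, that all accumulation points of $\{y_k\}$ are stationary points of $g(x,\cdot)$, and that $K\ge K_0$; in general $y^{\mathrm{cd}}(x)$ denotes a minimizer of $f(x,\cdot)$ over the set of accumulation points of the sequence $\{y_k\}$. *)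

(* Defs.v *)
From HB Require Import structures.
From mathcomp Require Import all_boot all_order all_algebra.
From mathcomp Require Import all_classical all_reals all_analysis.
Set Implicit Arguments.
Unset Strict Implicit.
Unset Printing Implicit Defensive.
Import Order.TTheory GRing.Theory Num.Theory.
Import numFieldNormedType.Exports.
Local Open Scope classical_set_scope.
Local Open Scope ring_scope.

(* Points of R^k are row vectors.  The library norm on 'rV[R]_k is the sup
   norm: it is used for the topology and for differentiability only, and all
   quantitative statements use the Euclidean norm [enorm] below. *)

Definition dotp (R : realType) (k : nat) (u v : 'rV[R]_k) : R :=
  \sum_(i < k) u 0 i * v 0 i.

Definition enorm (R : realType) (k : nat) (u : 'rV[R]_k) : R :=
  Num.sqrt (dotp u u).

(* Spectral norm, with A acting on row vectors (A and A^T have the same one);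
   the supremum is over a bounded set containing 0. *)
Definition opnorm (R : realType) (k l : nat) (A : 'M[R]_(k, l)) : R :=
  sup [set enorm (v *m A) | v in [set v : 'rV[R]_k | enorm v <= 1]].

(* Extended-real valued, so that the distance to the empty set is +oo. *)
Definition edistance (R : realType) (k : nat) (u : 'rV[R]_k)
    (A : set 'rV[R]_k) : \bar R :=
  ereal_inf [set (enorm (u - a))%:E | a in A].

Definition lipschitz_for (R : realType) (k : nat) (W : zmodType)
    (N : W -> R) (L : R) (A : set 'rV[R]_k) (F : 'rV[R]_k -> W) : Prop :=
  forall z w, A z -> A w -> N (F z - F w) <= L * enorm (z - w).

Definition grad (R : realType) (k : nat) (F : 'rV[R]_k -> R) (z : 'rV[R]_k) :
    'rV[R]_k :=
  \row_i 'D_(delta_mx 0 i) F z.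

Definition hess (R : realType) (k : nat) (F : 'rV[R]_k -> R) (z : 'rV[R]_k) :
    'M[R]_k :=
  \matrix_(i, j) 'D_(delta_mx 0 i) (fun w => grad F w 0 j) z.

(* Smoothness on a set that need not be open means smoothness on an open
   neighbourhood of it. *)
Definition C2_on (R : realType) (k : nat) (A : set 'rV[R]_k)
    (F : 'rV[R]_k -> R) : Prop :=
  exists U : set 'rV[R]_k, [/\ open U, A `<=` U &
    forall z, U z ->
      [/\ differentiable F z, differentiable (grad F) z &
          {for z, continuous (hess F)}]].

(* A function of (x, y) in R^n x R^m seen as a function on R^(n + m). *)
Definition joint (R : realType) (n m : nat) (T : Type)
    (h : 'rV[R]_n -> 'rV[R]_m -> T) (z : 'rV[R]_(n + m)) : T :=
  h (lsubmx z) (rsubmx z).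

Definition cylinder (R : realType) (n m : nat) (X : set 'rV[R]_n) :
    set 'rV[R]_(n + m) :=
  [set z | X (lsubmx z)].

Definition argmin (R : realType) (T : Type) (A : set T) (h : T -> R) (t : T) :
    Prop :=
  A t /\ forall t', A t' -> h t <= h t'.

Definition local_min (R : realType) (k : nat) (h : 'rV[R]_k -> R)
    (z : 'rV[R]_k) : Prop :=
  \forall w \near z, h z <= h w.

Definition morse (R : realType) (k : nat) (h : 'rV[R]_k -> R) : Prop :=
  forall z, grad h z = 0 -> \det (hess h z) != 0.

Definition sublevel (R : realType) (n m : nat)
    (g : 'rV[R]_n -> 'rV[R]_m -> R) (y0 : 'rV[R]_m) (x : 'rV[R]_n) :
    set 'rV[R]_m :=
  [set y | g x y <= g x y0].

Definition not_morse_set (R : realType) (n m : nat) (X : set 'rV[R]_n)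
    (g : 'rV[R]_n -> 'rV[R]_m -> R) : set 'rV[R]_n :=
  [set x | X x /\ ~ morse (g x)].

Definition not_morse_nbh (R : realType) (n m : nat) (X : set 'rV[R]_n)
    (g : 'rV[R]_n -> 'rV[R]_m -> R) (delta : R) : set 'rV[R]_n :=
  [set x | X x /\ (edistance x (not_morse_set X g) <= delta%:E)%E].

Definition crit (R : realType) (n m : nat) (Y' : set 'rV[R]_m)
    (g : 'rV[R]_n -> 'rV[R]_m -> R) (x : 'rV[R]_n) : set 'rV[R]_m :=
  [set y | Y' y /\ grad (g x) y = 0].

Definition crit_nbh (R : realType) (n m : nat) (Y' : set 'rV[R]_m)
    (g : 'rV[R]_n -> 'rV[R]_m -> R) (x : 'rV[R]_n) (r : R) : set 'rV[R]_m :=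
  [set y | (edistance y (crit Y' g x) <= r%:E)%E].

Definition cubic_model (R : realType) (k : nat) (h : 'rV[R]_k -> R) (M : R)
    (z s : 'rV[R]_k) : R :=
  dotp (grad h z) s + 2^-1 * dotp (s *m hess h z) s + M / 6 * enorm s ^+ 3.

(* The step s_k is y_(k+1) - y_k; when the model has several global minimizers
   any of them may be taken. *)
Definition cubic_newton (R : realType) (k : nat) (h : 'rV[R]_k -> R) (M : R)
    (y0 : 'rV[R]_k) (y : nat -> 'rV[R]_k) : Prop :=
  y 0%N = y0 /\
  forall i, argmin setT (cubic_model h M (y i)) (y i.+1 - y i).

(* Main.v *)
Require Import Defs.
From HB Require Import structures.
From mathcomp Require Import all_boot all_order all_algebra.
From mathcomp Require Import all_classical all_reals all_analysis.
From mathcomp Require Import ring lra.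
Set Implicit Arguments.
Unset Strict Implicit.
Unset Printing Implicit Defensive.
Import Order.TTheory GRing.Theory Num.Theory.
Import numFieldNormedType.Exports.
Local Open Scope classical_set_scope.
Local Open Scope ring_scope.

(** Fix x far from the degenerate parameters and write h = g(x, .), with
    gradient G and Hessian A, L for the Lipschitz constant of A and mu for the
    lower bound on the moduli of the eigenvalues of A at critical points.

    A cubic step s from y satisfies the stationarity equation
    G(y) + A(y) s + (L/2)|s| s = 0 and the curvature bound
    A(y) + (L/2)|s| I >= 0 ([cubic_stationary], [cubic_hess_ge]).  Against the
    Taylor estimates they show that the step lowers h by at least (L/12)|s|^3,
    and that a short step ends at a point where the gradient is small, at most
    L|s|^2, and the Hessian almost nonnegative, at least -(3/2)L|s|
    ([cubic_descent], [cubic_grad_le], [cubic_hess_next_ge]).  Since h is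
    bounded below, among N consecutive steps one has |s|^3 of order 1/N
    ([newton_short_step]); the two terms of the maximum K1 are the values of N
    that make the gradient and the negative curvature small enough after that
    step.

    At that moment the gradient is below alpha, so the iterate is close to a
    critical point z.  By Lipschitz continuity A(z) > -mu, and since no
    eigenvalue of A(z) lies in (-mu, mu), in fact A(z) >= mu
    ([positive_definite_of_eigenvalues], [basin_entry]): z is a nondegenerate
    minimizer, and not a saddle point.  Around z the Hessian stays above
    (3/4) mu, so every further step is controlled by the gradient, the
    gradient shrinks at least by a factor 4, and the iterates cannot leave the
    neighbourhood ([basin_step]).  Hence the whole sequence converges to z, its
    only accumulation point.  Every iterate of index larger than
    K1 lies in the basin, where the distance to z is at most 2|G|/mu
    ([in_basin_dist]); the steps between K1 and K number more than K2, so one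
    of them leads to a gradient below mu rho / 2, and the iterate of least
    gradient is within rho of z.

    Eigenvalues enter through the minimum of the Rayleigh quotient, which
    requires the Hessian to be symmetric; symmetry follows from the
    Taylor estimates themselves ([hess_sym]). *)

(** * Euclidean norm *)

Lemma dotpC (R : realType) k (u v : 'rV[R]_k) : dotp u v = dotp v u.
Proof. by apply: eq_bigr => i _; rewrite mulrC. Qed.

Lemma dotpDl (R : realType) k (u v w : 'rV[R]_k) :
  dotp (u + v) w = dotp u w + dotp v w.
Proof. by rewrite -big_split; apply: eq_bigr => i _; rewrite mxE mulrDl. Qed.

Lemma dotpZl (R : realType) k (a : R) (u w : 'rV[R]_k) :
  dotp (a *: u) w = a * dotp u w.
Proof. by rewrite mulr_sumr; apply: eq_bigr => i _; rewrite mxE mulrA. Qed.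

Lemma dotpNl (R : realType) k (u w : 'rV[R]_k) : dotp (- u) w = - dotp u w.
Proof. by rewrite -scaleN1r dotpZl mulN1r. Qed.

Lemma dotpBl (R : realType) k (u v w : 'rV[R]_k) :
  dotp (u - v) w = dotp u w - dotp v w.
Proof. by rewrite dotpDl dotpNl. Qed.

Lemma dotpDr (R : realType) k (u v w : 'rV[R]_k) :
  dotp w (u + v) = dotp w u + dotp w v.
Proof. by rewrite dotpC dotpDl !(dotpC w). Qed.

Lemma dotpZr (R : realType) k (a : R) (u w : 'rV[R]_k) :
  dotp w (a *: u) = a * dotp w u.
Proof. by rewrite dotpC dotpZl (dotpC w). Qed.

Lemma dotpNr (R : realType) k (u w : 'rV[R]_k) : dotp w (- u) = - dotp w u.
Proof. by rewrite dotpC dotpNl (dotpC w). Qed.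

Lemma dotpBr (R : realType) k (u v w : 'rV[R]_k) :
  dotp w (u - v) = dotp w u - dotp w v.
Proof. by rewrite dotpDr dotpNr. Qed.

Lemma dotp0l (R : realType) k (u : 'rV[R]_k) : dotp 0 u = 0.
Proof. by rewrite -(scale0r 0) dotpZl mul0r. Qed.

Definition dotpE := (dotpDl, dotpDr, dotpBl, dotpBr, dotpNl, dotpNr, dotpZl,
  dotpZr).

Lemma dotp_mulmx (R : realType) k (A : 'M[R]_k) (u v : 'rV[R]_k) :
  dotp (u *m A) v = \sum_i \sum_j u 0 i * A i j * v 0 j.
Proof.
rewrite exchange_big /=; apply: eq_bigr => j _.
by rewrite mxE mulr_suml.
Qed.

Lemma dotp_ge0 (R : realType) k (u : 'rV[R]_k) : 0 <= dotp u u.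
Proof. by apply: sumr_ge0 => i _; rewrite -expr2 sqr_ge0. Qed.

Lemma enorm_ge0 (R : realType) k (u : 'rV[R]_k) : 0 <= enorm u.
Proof. exact: sqrtr_ge0. Qed.

Lemma sqr_enorm (R : realType) k (u : 'rV[R]_k) : enorm u ^+ 2 = dotp u u.
Proof. by rewrite sqr_sqrtr // dotp_ge0. Qed.

Lemma dotp_eq0 (R : realType) k (u : 'rV[R]_k) : (dotp u u == 0) = (u == 0).
Proof.
apply/idP/eqP => [|->]; last by rewrite dotp0l.
rewrite psumr_eq0 => [|i _]; last by rewrite -expr2 sqr_ge0.
move=> /allP u0; apply/rowP => i; apply/eqP.
by have := u0 i (mem_index_enum i); rewrite /= -expr2 sqrf_eq0 mxE.
Qed.

Lemma enorm_eq0 (R : realType) k (u : 'rV[R]_k) : (enorm u == 0) = (u == 0).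
Proof. by rewrite -dotp_eq0 -sqr_enorm sqrf_eq0. Qed.

Lemma enorm0 (R : realType) k : enorm (0 : 'rV[R]_k) = 0.
Proof. by apply/eqP; rewrite enorm_eq0. Qed.

Lemma enorm_gt0 (R : realType) k (u : 'rV[R]_k) : (0 < enorm u) = (u != 0).
Proof. by rewrite lt0r enorm_ge0 andbT enorm_eq0. Qed.

Lemma enormZ (R : realType) k (a : R) (u : 'rV[R]_k) :
  enorm (a *: u) = `|a| * enorm u.
Proof.
apply/eqP; rewrite -(eqrXn2 (n := 2)) ?mulr_ge0 ?enorm_ge0 //.
by rewrite exprMn !sqr_enorm !dotpE real_normK ?num_real // expr2 mulrA.
Qed.

Lemma enormN (R : realType) k (u : 'rV[R]_k) : enorm (- u) = enorm u.
Proof. by rewrite -scaleN1r enormZ normrN1 mul1r. Qed.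

Lemma enormB (R : realType) k (u v : 'rV[R]_k) : enorm (u - v) = enorm (v - u).
Proof. by rewrite -enormN opprB. Qed.

(** Cauchy-Schwarz, from the nonnegativity of the squared norm of
    |v|^2 u - <u, v> v. *)
Lemma dotp_le (R : realType) k (u v : 'rV[R]_k) :
  dotp u v <= enorm u * enorm v.
Proof.
have [->|v0] := eqVneq v 0; first by rewrite dotpC dotp0l enorm0 mulr0.
have := dotp_ge0 (dotp v v *: u - dotp u v *: v).
rewrite !dotpE (dotpC v u) -!sqr_enorm.
set a := enorm u; set b := enorm v; set c := dotp u v.
have b0 : 0 < b by rewrite enorm_gt0.
have a0 : 0 <= a by exact: enorm_ge0.
move=> nneg; have {nneg}: 0 <= b ^+ 2 * ((a * b) ^+ 2 - c ^+ 2).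
  by apply: le_trans nneg _; rewrite le_eqVlt; apply/orP; left; apply/eqP; ring.
rewrite pmulr_rge0 ?exprn_gt0 // subr_ge0 => /(ler_wsqrtr (R := R)).
rewrite !sqrtr_sqr (ger0_norm (mulr_ge0 a0 (ltW b0))).
by apply: le_trans; rewrite ler_norm.
Qed.

Lemma dotp_ge (R : realType) k (u v : 'rV[R]_k) :
  - (enorm u * enorm v) <= dotp u v.
Proof. by have := dotp_le (- u) v; rewrite dotpNl enormN lerNl. Qed.

Lemma enormD (R : realType) k (u v : 'rV[R]_k) :
  enorm (u + v) <= enorm u + enorm v.
Proof.
rewrite -(ler_pXn2r (n := 2)) ?nnegrE ?addr_ge0 ?enorm_ge0 //.
rewrite sqrrD !sqr_enorm !dotpE (dotpC v u).
have := dotp_le u v; lra.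
Qed.

Lemma enorm_le_dotp (R : realType) k (u : 'rV[R]_k) (c : R) : 0 <= c ->
  (forall v, dotp u v <= c * enorm v) -> enorm u <= c.
Proof.
move=> c0 uc; have [->|u0] := eqVneq u 0; first by rewrite enorm0.
by have := uc u; rewrite -sqr_enorm expr2 ler_pM2r // enorm_gt0.
Qed.

Lemma coord_le_enorm (R : realType) k (u : 'rV[R]_k) i : `|u 0 i| <= enorm u.
Proof.
rewrite -(ler_pXn2r (n := 2)) ?nnegrE ?normr_ge0 ?enorm_ge0 //.
rewrite real_normK ?num_real // sqr_enorm /dotp (bigD1 i) //= -expr2 lerDl.
by apply: sumr_ge0 => j _; rewrite -expr2 sqr_ge0.
Qed.

Lemma enorm_le_sum (R : realType) k (u : 'rV[R]_k) :
  enorm u <= \sum_i `|u 0 i|.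
Proof.
have S0 : 0 <= \sum_i `|u 0 i| by apply: sumr_ge0.
rewrite -(ler_pXn2r (n := 2)) ?nnegrE ?enorm_ge0 // sqr_enorm expr2 mulr_sumr.
apply: ler_sum => i _; apply: le_trans (ler_norm _) _; rewrite normrM.
apply: ler_wpM2r => //; rewrite (bigD1 i) //= lerDl.
by apply: sumr_ge0.
Qed.

Lemma norm_le_enorm (R : realType) k (u : 'rV[R]_k) : `|u| <= enorm u.
Proof.
have [->|] := eqVneq `|u| 0; first exact: enorm_ge0.
move=> /mx_norm_neq0 [[i j]] /=; rewrite ord1 => E.
by have -> : `|u| = `|u 0 j| := E; exact: coord_le_enorm.
Qed.

(** The operator norm is a supremum, so this rests on the defining set being
    bounded; the sum of the norms of the columns of A is an upper bound. *)
Lemma enorm_mulmx_le (R : realType) k (A : 'M[R]_k) (v : 'rV[R]_k) :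
  enorm (v *m A) <= opnorm A * enorm v.
Proof.
have bounded :
    has_sup [set enorm (v *m A) | v in [set v : 'rV[R]_k | enorm v <= 1]].
  split; first by exists (enorm (0 *m A)); exists 0; rewrite //= enorm0 ler01.
  exists (\sum_j enorm (col j A)^T) => _ [w /= w1 <-].
  apply: le_trans (enorm_le_sum _) _; apply: ler_sum => j _.
  have -> : (w *m A) 0 j = dotp w (col j A)^T.
    by rewrite mxE; apply: eq_bigr => i _; rewrite !mxE.
  rewrite ler_norml; apply/andP; split.
    apply: le_trans (dotp_ge _ _); rewrite lerN2.
    exact: ler_piMl (enorm_ge0 _) w1.
  apply: le_trans (dotp_le _ _) _; exact: ler_piMl (enorm_ge0 _) w1.
have [->|v0] := eqVneq v 0; first by rewrite mul0mx enorm0 mulr0.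
have n0 : 0 < enorm v by rewrite enorm_gt0.
rewrite -ler_pdivrMr // mulrC.
have -> : (enorm v)^-1 * enorm (v *m A) = enorm (((enorm v)^-1 *: v) *m A).
  by rewrite -scalemxAl enormZ ger0_norm // invr_ge0 ltW.
apply: (ub_le_sup (proj2 bounded)); exists ((enorm v)^-1 *: v) => //=.
by rewrite enormZ ger0_norm ?invr_ge0 ?mulVf ?gt_eqF // ltW.
Qed.

(** * Taylor estimates with a Lipschitz Hessian *)

Lemma diff_grad (R : realType) k (F : 'rV[R]_k -> R) (z s : 'rV[R]_k) :
  differentiable F z -> 'd F z s = dotp (grad F z) s.
Proof.
move=> dF; rewrite {1}(row_sum_delta s) linear_sum; apply: eq_bigr => i _.
by rewrite linearZ /= mxE deriveE // mulrC.
Qed.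

Lemma is_derive_line (R : realType) k (F : 'rV[R]_k -> R) (y s : 'rV[R]_k) t :
  differentiable F (y + t *: s) ->
  is_derive t 1 (fun t => F (y + t *: s)) (dotp (grad F (y + t *: s)) s).
Proof.
move=> dF.
have [dl el] : is_diff t (fun t : R => y + t *: s) (fun t => t *: s).
  have -> : (fun t => t *: s) = 0 + *:%R ^~ s by rewrite add0r.
  exact: is_diffD.
apply: DeriveDef.
  by apply: diff_derivable; exact: differentiable_comp.
rewrite deriveE; last exact: differentiable_comp.
by rewrite diff_comp //= el scale1r diff_grad.
Qed.

(** Replaces the integration of a monomial bound on the derivative: the mean
    value theorem is applied to phi(t) - C t^(n+1)/(n+1), whose derivative is
    nonpositive. *)
Lemma ler_derive_monomial (R : realType) (phi dphi : R -> R) (C : R) n :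
  (forall t : R, is_derive t 1 phi (dphi t)) ->
  (forall t : R, 0 < t < 1 -> dphi t <= C * t ^+ n) ->
  phi 1 - phi 0 <= C / n.+1%:R.
Proof.
move=> dp dle.
pose psi := phi - (C / n.+1%:R) \*: (@id R) ^+ n.+1.
have dpsi (t : R) : is_derive t 1 psi (dphi t - C * t ^+ n).
  apply: is_derive_eq.
  rewrite /= /GRing.scale /= mulr1 mulrA.
  by rewrite divfK // pnatr_eq0.
have cpsi : {within `[0, 1], continuous psi}.
  apply: derivable_within_continuous => t _.
  exact: (@ex_derive _ _ _ _ _ _ _ (dpsi t)).
have [c] := @MVT _ psi _ 0 1 ltr01 (fun t _ => dpsi t) cpsi.
rewrite in_itv /= subr0 mulr1 => /dle dc E.
have := dc; rewrite -subr_le0 -E /psi.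
rewrite ?fctE /= /GRing.scale /= ?fctE ?expr1n ?expr0n /= mulr1 mulr0 subr0.
by rewrite addrAC subr_le0.
Qed.

Definition lip_hess (R : realType) k (L : R) (h : 'rV[R]_k -> R) : Prop :=
  [/\ forall z, differentiable h z, forall z, differentiable (grad h) z &
      lipschitz_for (@opnorm R k k) L setT (hess h)].

Lemma is_derive_grad_line (R : realType) k (h : 'rV[R]_k -> R)
    (y s u : 'rV[R]_k) t :
  differentiable (grad h) (y + t *: s) ->
  is_derive t 1 (fun t => dotp (grad h (y + t *: s)) u)
    (dotp (s *m hess h (y + t *: s)) u).
Proof.
move=> dg.
have -> : (fun t => dotp (grad h (y + t *: s)) u) =
    \sum_j (u 0 j \*: (fun t => grad h (y + t *: s) 0 j)).
  apply/funext => r; rewrite fct_sumE; apply: eq_bigr => j _.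
  by rewrite mulrC.
have -> : dotp (s *m hess h (y + t *: s)) u =
    \sum_j u 0 j *: dotp (grad (fun w => grad h w 0 j) (y + t *: s)) s.
  apply: eq_bigr => j _; rewrite mulrC; congr (_ * _).
  by rewrite mxE; apply: eq_bigr => i _; rewrite !mxE mulrC.
apply: is_derive_sum => j; apply: is_deriveZ; apply: is_derive_line.
by apply: (@differentiable_comp _ _ _ _ (grad h) (fun w => w 0 j));
  [exact: dg|exact: differentiable_coord].
Qed.

Lemma lip_hessP (R : realType) k L (h : 'rV[R]_k -> R) (z w s u : 'rV[R]_k) :
  lip_hess L h ->
  dotp (s *m hess h z) u - dotp (s *m hess h w) u <=
    L * enorm (z - w) * enorm s * enorm u.
Proof.
case=> _ _ Hl; rewrite -dotpBl -mulmxBr.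
apply: le_trans (dotp_le _ _) _; apply: ler_wpM2r; first exact: enorm_ge0.
apply: le_trans (enorm_mulmx_le _ _) _; apply: ler_wpM2r; first exact: enorm_ge0.
exact: Hl.
Qed.

(** Testing against a fixed direction u keeps the argument one-dimensional: the
    derivative of t |-> <grad h(y + ts), u> differs from its value at 0 by at
    most L t |s|^2 |u|.  Since u is arbitrary, -u gives the opposite bound. *)
Lemma grad_taylor_le (R : realType) k L (h : 'rV[R]_k -> R) (y s u : 'rV[R]_k) :
  lip_hess L h ->
  dotp (grad h (y + s)) u - dotp (grad h y) u - dotp (s *m hess h y) u <=
    L / 2 * enorm s ^+ 2 * enorm u.
Proof.
move=> H.
pose phi := (fun t : R => dotp (grad h (y + t *: s)) u) -
  (dotp (s *m hess h y) u) \*: @id R.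
have dphi (t : R) : is_derive t 1 phi
    (dotp (s *m hess h (y + t *: s)) u - dotp (s *m hess h y) u).
  have d1 : is_derive t 1 (fun t : R => dotp (grad h (y + t *: s)) u)
    (dotp (s *m hess h (y + t *: s)) u).
    by apply: is_derive_grad_line; case: H => _ + _; exact.
  by apply: is_derive_eq; rewrite /GRing.scale /= mulr1.
have e1 : phi 1 = dotp (grad h (y + s)) u - dotp (s *m hess h y) u.
  by rewrite /phi !fctE scale1r /= [_%:A]mulr1.
have e0 : phi 0 = dotp (grad h y) u.
  by rewrite /phi !fctE scale0r addr0 /= [_ *: 0]mulr0 subr0.
have := @ler_derive_monomial _ phi _ (L * enorm s ^+ 2 * enorm u) 1 dphi.
have -> : L * enorm s ^+ 2 * enorm u / 2 = L / 2 * enorm s ^+ 2 * enorm u.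
  by ring.
rewrite e1 e0 [X in _ -> X <= _]addrAC; apply => t /andP[t0 _].
apply: le_trans (lip_hessP _ _ _ _ H) _.
rewrite [y + _]addrC addrK enormZ gtr0_norm // expr1 le_eqVlt.
by apply/orP; left; apply/eqP; ring.
Qed.

(** The derivative of the remainder along the segment is bounded by
    [grad_taylor_le] with u = s, which is quadratic in t. *)
Lemma taylor_le (R : realType) k L (h : 'rV[R]_k -> R) (y s : 'rV[R]_k) :
  lip_hess L h ->
  h (y + s) - h y - dotp (grad h y) s - 2^-1 * dotp (s *m hess h y) s <=
    L / 6 * enorm s ^+ 3.
Proof.
move=> H.
pose phi := (fun t : R => h (y + t *: s)) -
  ((dotp (grad h y) s) \*: @id R +
   (2^-1 * dotp (s *m hess h y) s) \*: @id R ^+ 2).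
have dphi (t : R) : is_derive t 1 phi
    (dotp (grad h (y + t *: s)) s -
      (dotp (grad h y) s + t * dotp (s *m hess h y) s)).
  have d1 : is_derive t 1 (fun t : R => h (y + t *: s))
    (dotp (grad h (y + t *: s)) s).
    by apply: is_derive_line; case: H => + _ _; exact.
  apply: is_derive_eq; rewrite /GRing.scale /=. by field.
have e1 : phi 1 =
    h (y + s) - (dotp (grad h y) s + 2^-1 * dotp (s *m hess h y) s).
  by rewrite /phi !fctE scale1r /= ?fctE expr1n ![_%:A]mulr1.
have e0 : phi 0 = h y.
  rewrite /phi !fctE scale0r addr0 /= ?fctE expr0n.
  by rewrite ![_ *: 0]mulr0 addr0 subr0.
have := @ler_derive_monomial _ phi _ (L / 2 * enorm s ^+ 3) 2 dphi.
have -> : L / 2 * enorm s ^+ 3 / 3 = L / 6 * enorm s ^+ 3 by field.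
rewrite e1 e0 => le.
have {}le :
    h (y + s) - (dotp (grad h y) s + 2^-1 * dotp (s *m hess h y) s) - h y <=
    L / 6 * enorm s ^+ 3; last by move: le; lra.
apply: le => t /andP[t0 _].
have := grad_taylor_le y (t *: s) s H.
rewrite -scalemxAl dotpZl enormZ gtr0_norm // => le.
have -> : L / 2 * enorm s ^+ 3 * t ^+ 2 =
  L / 2 * (t * enorm s) ^+ 2 * enorm s by ring.
by move: le; lra.
Qed.

(** Used to extract first-order information from inequalities that hold for all
    small steps t, after division by the leading power of t. *)
Lemma perturb_ge0 (R : realFieldType) (a c : R) :
  (forall t, 0 < t <= 1 -> 0 <= a + c * t) -> 0 <= a.
Proof.
move=> ac; rewrite leNgt; apply/negP => a0.
have c1 : 0 <= `|c| by [].
have d0 : 0 < 2 * (`|c| + 1) - a by lra.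
have /ac : 0 < - a / (2 * (`|c| + 1) - a) <= 1.
  by rewrite divr_gt0 ?oppr_gt0 // ler_pdivrMr // mul1r; lra.
rewrite mulrA -[X in X + _](mulfK (lt0r_neq0 d0)) -mulrDl.
rewrite pmulr_lge0 ?invr_gt0 //.
have := ler_norm c; move: c1 a0; move: `|c| => b; nra.
Qed.

(** The upper estimate taken from y + s back to y, followed by the transport of
    the gradient and of the Hessian from y + s to y.  The constant 7/6 is the sum
    1/6 + 1/2 + 1/2 of the three errors; the optimal one is 1/6, but only the
    cubic order matters for the uses below. *)
Lemma taylor_ge (R : realType) k L (h : 'rV[R]_k -> R) (y s : 'rV[R]_k) :
  lip_hess L h ->
  - (7 / 6 * L * enorm s ^+ 3) <=
    h (y + s) - h y - dotp (grad h y) s - 2^-1 * dotp (s *m hess h y) s.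
Proof.
move=> H.
have := lip_hessP (y + s) y s s H.
have := grad_taylor_le y s (- s) H.
have := taylor_le (y + s) (- s) H.
move: (grad h) (hess h) => G A.
rewrite addrK !enormN mulNmx !(dotpNl, dotpNr) opprK [y + s - y]addrC addKr.
move: (enorm s) (h y) (h (y + s)) (dotp (G y) s) (dotp (G (y + s)) s)
  (dotp (s *m A y) s) (dotp (s *m A (y + s)) s) => e a b p q r t.
lra.
Qed.

(** Expand h(y + ta + tb) directly from y, and also in two stages through y + ta.
    The first expansion contains half of <aA, b> + <bA, a>, the second contains
    <aA, b> alone, and they agree up to O(t^3). *)
Lemma hess_sym (R : realType) k L (h : 'rV[R]_k -> R) (y u v : 'rV[R]_k) :
  lip_hess L h -> dotp (u *m hess h y) v = dotp (v *m hess h y) u.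
Proof.
move=> H; suff le a b : dotp (a *m hess h y) b <= dotp (b *m hess h y) a.
  by apply/eqP; rewrite eq_le !le.
rewrite -subr_ge0.
pose C := L / 6 * enorm (a + b) ^+ 3 + 7 / 6 * L * enorm a ^+ 3 +
  7 / 6 * L * enorm b ^+ 3 + L / 2 * enorm a ^+ 2 * enorm b +
  L / 2 * enorm a * enorm b ^+ 2.
apply: (@perturb_ge0 _ _ (2 * C)) => t /andP[t0 _].
have n0 : `|t| = t by rewrite gtr0_norm.

have := taylor_le y (t *: (a + b)) H.
have := taylor_ge y (t *: a) H.
have := taylor_ge (y + t *: a) (t *: b) H.
have := grad_taylor_le y (t *: a) (- (t *: b)) H.
have := lip_hessP y (y + t *: a) (t *: b) (t *: b) H.
rewrite /C; move: (grad h) (hess h) => G A.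
rewrite enormB [y + _ - y]addrC addKr -[y + _ + _]addrA -scalerDr.
rewrite !enormN !enormZ n0.
rewrite -!scalemxAl mulmxDl !(dotpNr, dotpZl, dotpZr, dotpDl, dotpDr).
move: (dotp (b *m A (y + t *: a)) b) (dotp (G (y + t *: a)) b) => q p.
move: (h y) (h (y + t *: a)) (h (y + t *: (a + b))) => c0 c1 c2.
move: (dotp (a *m A y) a) (dotp (b *m A y) b) (dotp (a *m A y) b)
  (dotp (b *m A y) a) (dotp (G y) a) (dotp (G y) b) => c3 c4 c5 c6 c7 c8.
move: (enorm (a + b)) (enorm a) (enorm b) => c9 c10 c11 h1 h2 h3 h4 h5.
rewrite -(pmulr_rge0 _ (exprn_gt0 2 t0)).
lra.
Qed.

(** * Restriction to a fixed upper-level variable *)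

Lemma differentiable_slice (R : realType) n m (V : normedModType R)
    (F : 'rV[R]_(n + m) -> V) (x : 'rV[R]_n) (z : 'rV[R]_m) :
  differentiable F (row_mx x z) ->
  differentiable (fun w : 'rV[R]_m => F (row_mx x w)) z.
Proof.
move=> dF.
apply: (@differentiable_comp _ _ _ _ (fun w : 'rV[R]_m => row_mx x w) F) => //.
have -> : (fun w : 'rV[R]_m => row_mx x w) =
    cst (row_mx x 0) +
    \sum_j (fun w : 'rV[R]_m => w 0 j *: row_mx 0 (delta_mx 0 j)).
  apply/funext => w; rewrite !fctE fct_sumE.
  have -> : \sum_j w 0 j *: row_mx 0 (delta_mx 0 j) = row_mx (0 : 'rV[R]_n) w.
    rewrite -[LHS]hsubmxK !linear_sum /=; congr row_mx.
      by rewrite big1 // => j _; rewrite linearZ /= row_mxKl scaler0.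
    rewrite [RHS]row_sum_delta; apply: eq_bigr => j _.
    by rewrite linearZ /= row_mxKr.
  by rewrite add_row_mx addr0 add0r.
apply: differentiableD; first exact: differentiable_cst.
apply: differentiable_sum => j; apply: differentiableZl.
exact: differentiable_coord.
Qed.

(** Difference quotients of g(x, .) along the i-th axis are literally difference
    quotients of the joint function along the axis n + i. *)
Lemma grad_slice (R : realType) n m (g : 'rV[R]_n -> 'rV[R]_m -> R) x z :
  grad (g x) z = rsubmx (grad (joint g) (row_mx x z)).
Proof.
apply/rowP => i; rewrite !mxE /derive.
suff -> :
    (fun t : R => t^-1 *: ((g x \o shift z) (t *: delta_mx 0 i) - g x z)) =
    (fun t => t^-1 *: ((joint g \o shift (row_mx x z))
        (t *: delta_mx 0 (rshift n i)) - joint g (row_mx x z))) by [].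
apply/funext => t; rewrite /joint /= row_mxKl row_mxKr.
have -> : delta_mx 0 (rshift n i) = row_mx 0 (delta_mx 0 i) :> 'rV[R]_(n + m).
  rewrite -[LHS]hsubmxK; congr row_mx; apply/rowP => j;
  by rewrite !mxE ?eq_shift.
by rewrite scale_row_mx add_row_mx row_mxKl row_mxKr scaler0 add0r.
Qed.

(** Differentiability of g(x, .) and of its gradient is inherited from the joint
    function through the affine map w |-> (x, w), which is also an isometry, so
    that the Lipschitz constant is kept. *)
Lemma slice_lip_hess (R : realType) n m (X : set 'rV[R]_n)
    (g : 'rV[R]_n -> 'rV[R]_m -> R) L x : X x ->
  C2_on (cylinder X) (joint g) ->
  lipschitz_for (@opnorm R m m) L (cylinder X)
    (joint (fun x => hess (g x))) ->
  lip_hess L (g x).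
Proof.
move=> Xx [U [_ XU smooth]] lip.
have Xxw w : cylinder X (row_mx x w : 'rV[R]_(n + m)).
  by rewrite /cylinder /= row_mxKl.
have gE : g x = fun w => joint g (row_mx x w).
  by apply/funext => w; rewrite /joint row_mxKl row_mxKr.
split=> [z|z|z w _ _].
- by rewrite gE; apply: differentiable_slice; case: (smooth _ (XU _ (Xxw z))).
- have -> : grad (g x) = fun w => rsubmx (grad (joint g) (row_mx x w)).
    by apply/funext => w; exact: grad_slice.
  apply: (@differentiable_slice _ _ _ _ (fun v => rsubmx (grad (joint g) v))).
  apply: differentiable_comp; last exact: differentiable_rsubmx.
  by case: (smooth _ (XU _ (Xxw z))).
have := lip _ _ (Xxw z) (Xxw w).
rewrite /joint !row_mxKl !row_mxKr => /le_trans; apply.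
rewrite opp_row_mx add_row_mx subrr.
have -> // : enorm (row_mx (0 : 'rV[R]_n) (z - w)) = enorm (z - w).
rewrite /enorm /dotp big_split_ord /= big1 ?add0r => [|i _]; last first.
  by rewrite !row_mxEl !mxE mul0r.
by congr Num.sqrt; apply: eq_bigr => i _; rewrite !row_mxEr.
Qed.

(** * The cubic-regularized step *)

(** With r = |s| and a = |s + v|, the identity
    a^3 - r^3 = (3/2) r (a^2 - r^2) + (a - r)^2 (a + r/2) isolates in the cubic
    term what is linear and quadratic in v.  The last term is a second-order
    error in general, and vanishes when a = r. *)
Lemma cubic_model_expand (R : realType) k L (h : 'rV[R]_k -> R)
    (y s v : 'rV[R]_k) : lip_hess L h ->
  let r := enorm s in let a := enorm (s + v) in
  cubic_model h L y (s + v) - cubic_model h L y s =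
  dotp (grad h y + s *m hess h y + (L / 2 * r) *: s) v +
  2^-1 * (dotp (v *m hess h y) v + L / 2 * r * dotp v v) +
  L / 6 * ((a - r) ^+ 2 * (a + r / 2)).
Proof.
move=> H r a; rewrite /cubic_model -/r -/a.
have : a ^+ 2 = r ^+ 2 + 2 * dotp s v + dotp v v.
  by rewrite !sqr_enorm !(dotpDl, dotpDr) (dotpC v s); ring.
have := hess_sym y s v H; move: (grad h y) (hess h y) => G A.
rewrite mulmxDl !(dotpDl, dotpDr, dotpZl) => -> a2.
have -> : L / 6 * ((a - r) ^+ 2 * (a + r / 2)) =
  L / 6 * (a ^+ 3 + r ^+ 3 / 2 - 3 / 2 * r * a ^+ 2) by field.
rewrite a2.
by field.
Qed.

(** Moving from s against the candidate gradient w of the model, s - t w, would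
    decrease the model at first order in t if w were not zero. *)
Lemma cubic_stationary (R : realType) k L (h : 'rV[R]_k -> R)
    (y s : 'rV[R]_k) : lip_hess L h -> 0 < L ->
  argmin setT (cubic_model h L y) s ->
  grad h y + s *m hess h y + (L / 2 * enorm s) *: s = 0.
Proof.
move=> H L0 [_ smin]; set w := _ + _ + _.
apply/eqP; rewrite -dotp_eq0 eq_le dotp_ge0 andbT -oppr_ge0.
have r0 := enorm_ge0 s; have w0 := enorm_ge0 w; set r := enorm s in r0 *.
pose Q := dotp (w *m hess h y) w + L / 2 * r * dotp w w.
apply: (@perturb_ge0 _ _
  (2^-1 * Q + L / 6 * (enorm w ^+ 2 * (3 / 2 * r + enorm w)))).
move=> t /andP[t0 t1].
have := smin (s + - t *: w) I; rewrite -subr_ge0 (cubic_model_expand _ _ _ H).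
rewrite -/w -/r -scalemxAl !(dotpZl, dotpZr).
set a := enorm (s + _) => ge0.
have an : a <= r + t * enorm w.
  by apply: le_trans (enormD _ _) _; rewrite enormZ normrN gtr0_norm.
have na : r <= a + t * enorm w.
  have := enormD (s + - t *: w) (t *: w).
  by rewrite scaleNr subrK -scaleNr enormZ gtr0_norm.
have a0 : 0 <= a := enorm_ge0 _.
have sq : (a - r) ^+ 2 <= t ^+ 2 * enorm w ^+ 2.
  rewrite -exprMn -[leRHS]real_normK ?num_real //.
  rewrite -[leLHS]real_normK ?num_real //.
  rewrite ler_pXn2r ?nnegrE ?normr_ge0 //.
  rewrite [X in _ <= X]ger0_norm ?mulr_ge0 ?(ltW t0) // ler_norml; lra.
have cub : (a - r) ^+ 2 * (a + r / 2) <=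
    t ^+ 2 * (enorm w ^+ 2 * (3 / 2 * r + enorm w)).
  rewrite mulrA; apply: ler_pM => //; [exact: sqr_ge0|lra|].
  have := ler_piMl w0 t1; lra.
have {}cub := ler_wpM2l (ltW L0) cub.
move: ge0 cub; rewrite /Q -subr_ge0.
move: (dotp (w *m hess h y) w) (dotp w w) (enorm w) => q ww ew ge0 cub.
rewrite -(pmulr_rge0 _ t0); lra.
Qed.

(** By [cubic_model_expand] and stationarity, the quadratic form
    Q = A + (L/2)|s| I is nonnegative on each displacement v with |s + v| = |s|.
    Each direction that is not orthogonal to s contains such a displacement, the
    one that reflects s.  In an orthogonal direction |s + tv| - |s| is at most
    t|v| while the difference of the squares is t^2 |v|^2, so the error term is
    O(t^3), negligible against t^2 Q(v). *)
Lemma cubic_hess_ge (R : realType) k L (h : 'rV[R]_k -> R)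
    (y s v : 'rV[R]_k) : lip_hess L h -> 0 < L ->
  argmin setT (cubic_model h L y) s ->
  - (L / 2 * enorm s * enorm v ^+ 2) <= dotp (v *m hess h y) v.
Proof.
move=> H L0 smin; rewrite sqr_enorm -subr_ge0 opprK.
have expand u : 0 <=
  2^-1 * (dotp (u *m hess h y) u + L / 2 * enorm s * dotp u u) +
  L / 6 * ((enorm (s + u) - enorm s) ^+ 2 * (enorm (s + u) + enorm s / 2)).
  have := (proj2 smin) (s + u) I.
  rewrite -subr_ge0 (cubic_model_expand _ _ _ H) (cubic_stationary H L0 smin).
  by rewrite dotp0l add0r.
have r0 := enorm_ge0 s; have v0 := enorm_ge0 v.
have norm2 u : enorm (s + u) ^+ 2 = enorm s ^+ 2 + 2 * dotp s u + dotp u u.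
  by rewrite !sqr_enorm !(dotpDl, dotpDr) (dotpC u s); ring.
have [sv|sv] := eqVneq (dotp s v) 0.
  apply: (@perturb_ge0 _ _ (L / 3 * enorm v ^+ 3)) => t /andP[t0 _].
  have a0 := enorm_ge0 (s + t *: v).
  have := expand (t *: v); have := norm2 (t *: v).
  have : enorm (s + t *: v) <= enorm s + t * enorm v.
    by apply: le_trans (enormD _ _) _; rewrite enormZ gtr0_norm.
  rewrite -scalemxAl !(dotpZl, dotpZr) sv -!sqr_enorm.
  move: a0; move: (enorm (s + t *: v)) (dotp (v *m hess h y) v).
  move=> a q a0 an a2 ge0.
  have ra : enorm s <= a.
    rewrite -(ler_pXn2r (n := 2)) ?nnegrE // a2; nra.
  have cub : (a - enorm s) ^+ 2 * (a + enorm s / 2) <= t ^+ 3 * enorm v ^+ 3.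
    apply: (@le_trans _ _ ((a - enorm s) * (a ^+ 2 - enorm s ^+ 2))).
      rewrite -subr_ge0; set d := _ - _.
      have -> : d = (a - enorm s) ^+ 2 * (enorm s / 2) by rewrite /d; field.
      by rewrite mulr_ge0 ?sqr_ge0 // divr_ge0.
    have -> : a ^+ 2 - enorm s ^+ 2 = t ^+ 2 * enorm v ^+ 2 by rewrite a2; ring.
    have -> : t ^+ 3 * enorm v ^+ 3 =
      (t * enorm v) * (t ^+ 2 * enorm v ^+ 2) by ring.
    by apply: ler_wpM2r; [rewrite mulr_ge0 ?sqr_ge0|lra].
  have {}cub := ler_wpM2l (ltW L0) cub.
  rewrite -(pmulr_rge0 _ (exprn_gt0 2 t0)); lra.
have vv : 0 < dotp v v.
  rewrite lt0r dotp_ge0 dotp_eq0 andbT.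
  by apply: contra_neq sv => ->; rewrite dotpC dotp0l.
(* s + c v is the reflection of s in the hyperplane orthogonal to v. *)
pose c := - 2 * dotp s v / dotp v v.
have c0 : c != 0.
  by rewrite !mulf_neq0 ?invr_neq0 ?(gt_eqF vv) // lt_eqF // oppr_lt0.
have Ea : enorm (s + c *: v) = enorm s.
  apply/eqP; rewrite -(eqrXn2 (n := 2)) ?enorm_ge0 // norm2; apply/eqP.
  by rewrite !(dotpZl, dotpZr) /c; field; rewrite gt_eqF.
have := expand (c *: v); rewrite Ea subrr expr0n mul0r mulr0 addr0.
rewrite -scalemxAl !(dotpZl, dotpZr).
set q := dotp (v *m _) v; set p := dotp v v.
have -> : 2^-1 * (c * (c * q) + L / 2 * enorm s * (c * (c * p))) =
  c ^+ 2 * (2^-1 * (q + L / 2 * enorm s * p)) by ring.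
have c2 : 0 < c ^+ 2 by rewrite exprn_even_gt0.
by rewrite (pmulr_rge0 _ c2) pmulr_rge0 // invr_gt0.
Qed.

(** Stationarity turns the linear term of the Taylor expansion into
    -<sA, s> - (L/2)|s|^3, and the curvature bound gives <sA, s> >= -(L/2)|s|^3. *)
Lemma cubic_descent (R : realType) k L (h : 'rV[R]_k -> R)
    (y s : 'rV[R]_k) : lip_hess L h -> 0 < L ->
  argmin setT (cubic_model h L y) s ->
  L / 12 * enorm s ^+ 3 <= h y - h (y + s).
Proof.
move=> H L0 smin.
have := taylor_le y s H; have := cubic_hess_ge s H L0 smin.
have : dotp (grad h y + s *m hess h y + (L / 2 * enorm s) *: s) s = 0.
  by rewrite (cubic_stationary H L0 smin) dotp0l.
move: (grad h y) (hess h y) => G A.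
rewrite !(dotpDl, dotpZl) -sqr_enorm.
move: (dotp G s) (dotp _ s) (enorm s) (h y) (h (y + s)) => a b c d e; lra.
Qed.

(** One half of L|s|^2 is the Taylor remainder of the gradient, the other half is
    the cubic term of the stationarity equation. *)
Lemma cubic_grad_le (R : realType) k L (h : 'rV[R]_k -> R)
    (y s : 'rV[R]_k) : lip_hess L h -> 0 < L ->
  argmin setT (cubic_model h L y) s ->
  enorm (grad h (y + s)) <= L * enorm s ^+ 2.
Proof.
move=> H L0 smin; apply: enorm_le_dotp => [|u].
  by rewrite mulr_ge0 ?sqr_ge0 // ltW.
have := grad_taylor_le y s u H.
have : dotp (grad h y + s *m hess h y + (L / 2 * enorm s) *: s) u = 0.
  by rewrite (cubic_stationary H L0 smin) dotp0l.
have : L / 2 * enorm s * - dotp s u <= L / 2 * enorm s * (enorm s * enorm u).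
  have r0 := enorm_ge0 s.
  apply: ler_wpM2l; first nra.
  by rewrite lerNl dotp_ge.
move: (grad h) (hess h) => G A; rewrite !(dotpDl, dotpZl).
move: (dotp (G y) u) (dotp (G (y + s)) u) (dotp s u) (dotp (s *m A y) u).
move: (enorm s) (enorm u).
move=> a b c d e f; lra.
Qed.

Lemma cubic_hess_next_ge (R : realType) k L (h : 'rV[R]_k -> R)
    (y s v : 'rV[R]_k) : lip_hess L h -> 0 < L ->
  argmin setT (cubic_model h L y) s ->
  - (3 / 2 * L * enorm s * enorm v ^+ 2) <= dotp (v *m hess h (y + s)) v.
Proof.
move=> H L0 smin; have := cubic_hess_ge v H L0 smin.
have := lip_hessP y (y + s) v v H; rewrite enormB [y + s - y]addrC addKr.
move: (hess h) => A.
move: (dotp (v *m A y) v) (dotp (v *m A (y + s)) v) (enorm s) (enorm v).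
by move=> a b c d; lra.
Qed.

(** * Positive definite Hessians *)

Lemma continuous_quadratic (R : realType) k (A : 'M[R]_k) :
  continuous (fun u : 'rV[R]_k => dotp (u *m A) u).
Proof.
have -> : (fun u : 'rV[R]_k => dotp (u *m A) u) =
    (fun u => \sum_i \sum_j u 0 i * A i j * u 0 j).
  by apply/funext => u; rewrite dotp_mulmx.
apply: continuous_big => [|i _]; first exact: add_continuous.
apply: continuous_big => [|j _ u]; first exact: add_continuous.
apply: (@continuousM _ _ (fun u : 'rV[R]_k => u 0 i * A i j) (fun u => u 0 j)).
  apply: (@continuousM _ _ (fun u : 'rV[R]_k => u 0 i) (fun=> A i j)).
    exact: coord_continuous.
  exact: cst_continuous.
exact: coord_continuous.
Qed.

Lemma continuous_dotp (R : realType) k :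
  continuous (fun u : 'rV[R]_k => dotp u u).
Proof.
move=> u; have := @continuous_quadratic R k 1%:M u.
by under eq_fun do rewrite mulmx1.
Qed.

Lemma continuous_enorm (R : realType) k : continuous (@enorm R k).
Proof.
move=> u; apply: (@continuous_comp _ _ _ (fun u : 'rV[R]_k => dotp u u)).
  exact: continuous_dotp.
exact: sqrt_continuous.
Qed.

(** A minimizer w of the quadratic form on the unit sphere is an eigenvector:
    with l the minimum, A - l I is a nonnegative form that vanishes at w, and its
    variation along w - t d, where d = wA - l w, forces d = 0. *)
Lemma rayleigh_min (R : realType) k (A : 'M[R]_k) (v : 'rV[R]_k) : v != 0 ->
  (forall u w : 'rV[R]_k, dotp (u *m A) w = dotp (w *m A) u) ->
  exists w : 'rV[R]_k, [/\ enorm w = 1, w *m A = dotp (w *m A) w *: w &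
    forall u, dotp (w *m A) w * enorm u ^+ 2 <= dotp (u *m A) u].
Proof.
move=> v0 symA; pose S := [set u : 'rV[R]_k | enorm u = 1].
have S0 : S !=set0.
  exists ((enorm v)^-1 *: v).
  rewrite /S /= enormZ ger0_norm ?invr_ge0 ?enorm_ge0 //.
  by rewrite mulVf // enorm_eq0.
have Sc : compact S.
  apply: bounded_closed_compact.
    exists 1; split; first exact: num_real.
    by move=> M M1 u /= u1; apply: le_trans (norm_le_enorm u) _; rewrite u1 ltW.
  apply: (@preimage_closed _ _ (@enorm R k) [set r | r = 1]).
    by move=> u _; exact: continuous_enorm.
  exact: closed_eq.
have [w wS wmin] := EVT_min_rV S0 Sc
  (continuous_subspaceT (@continuous_quadratic R k A)).
have {wS}w1 : enorm w = 1 by move: wS; rewrite inE.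
set l := dotp (w *m A) w in wmin *.
have low u : l * enorm u ^+ 2 <= dotp (u *m A) u.
  have [->|u0] := eqVneq u 0.
    by rewrite enorm0 expr0n mulr0 mul0mx dotp0l.
  have n0 : enorm u != 0 by rewrite enorm_eq0.
  have := wmin ((enorm u)^-1 *: u); rewrite -scalemxAl !(dotpZl, dotpZr).
  rewrite inE /S /= enormZ ger0_norm ?invr_ge0 ?enorm_ge0 // mulVf //.
  move=> /(_ erefl).
  rewrite mulrA -expr2 exprVn mulrC ler_pdivlMr //.
  by rewrite exprn_gt0 // enorm_gt0.
exists w; split=> //; apply/eqP; rewrite -subr_eq0.
set d := _ - _; rewrite -dotp_eq0 eq_le dotp_ge0 andbT -oppr_ge0.
(* The derivative of the form A - l I at w along d is twice |d|^2. *)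
have dE : dotp (w *m A) d - l * dotp w d = dotp d d.
  by rewrite {2}/d dotpBl dotpZl.
clearbody d; pose Q := dotp (d *m A) d - l * enorm d ^+ 2.
apply: (@perturb_ge0 _ _ (2^-1 * Q)) => t /andP[t0 _].
have := low (w + - t *: d).
rewrite sqr_enorm mulmxDl -scalemxAl !(dotpDl, dotpDr, dotpZl, dotpZr).
rewrite (symA d w) (dotpC d w) -/l -(sqr_enorm w) w1 => le.
rewrite -(pmulr_rge0 _ t0) /Q sqr_enorm; move: dE le.
move: (dotp (w *m A) d) (dotp w d) (dotp d d) (dotp (d *m A) d) => p q r m.
by move=> <-; lra.
Qed.

(** The spectral gap: the smallest eigenvalue exceeds -mu, so its modulus can be
    at least mu only if the eigenvalue itself is. *)
Lemma positive_definite_of_eigenvalues (R : realType) k (A : 'M[R]_k)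
    (mu c : R) :
  (forall u w : 'rV[R]_k, dotp (u *m A) w = dotp (w *m A) u) ->
  (forall lambda : R, eigenvalue A lambda -> mu <= `|lambda|) -> c < mu ->
  (forall v, - (c * enorm v ^+ 2) <= dotp (v *m A) v) ->
  forall v, mu * enorm v ^+ 2 <= dotp (v *m A) v.
Proof.
move=> symA mu_eig c_mu low v.
have [->|v0] := eqVneq v 0; first by rewrite enorm0 expr0n mulr0 mul0mx dotp0l.
have [w [w1 wE wmin]] := rayleigh_min v0 symA.
apply: le_trans (wmin v); apply: ler_wpM2r; first exact: sqr_ge0.
have := low w; rewrite w1 expr1n mulr1 => lc.
have : eigenvalue A (dotp (w *m A) w).
  by apply/eigenvalueP; exists w; rewrite // -enorm_gt0 w1.
move=> /mu_eig; rewrite ler_normr => /orP[//|]; lra.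
Qed.

Lemma hess_near_ge (R : realType) k L (h : 'rV[R]_k -> R)
    (y z v : 'rV[R]_k) mu :
  lip_hess L h -> (forall v, mu * enorm v ^+ 2 <= dotp (v *m hess h z) v) ->
  (mu - L * enorm (y - z)) * enorm v ^+ 2 <= dotp (v *m hess h y) v.
Proof.
move=> H /(_ v) pd; have := lip_hessP z y v v H; rewrite enormB.
move: pd; move: (hess h) => A.
move: (dotp (v *m A z) v) (dotp (v *m A y) v) (enorm (y - z)) (enorm v).
by move=> p q c d; lra.
Qed.

(** Taylor expansion of the gradient from z, tested against y - z. *)
Lemma grad_near_ge (R : realType) k L (h : 'rV[R]_k -> R) (y z : 'rV[R]_k) mu :
  lip_hess L h -> grad h z = 0 ->
  (forall v, mu * enorm v ^+ 2 <= dotp (v *m hess h z) v) ->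
  (mu - L / 2 * enorm (y - z)) * enorm (y - z) <= enorm (grad h y).
Proof.
move=> H gz pd.
have [->|yz] := eqVneq y z; first by rewrite subrr enorm0 mulr0 enorm_ge0.
have d0 : 0 < enorm (y - z) by rewrite enorm_gt0 subr_eq0.
have := grad_taylor_le z (y - z) (- (y - z)) H.
have := pd (y - z); have := dotp_le (grad h y) (y - z).
rewrite [z + _]addrC subrK gz; move: (grad h y) (hess h z) => G A.
rewrite dotp0l enormN !dotpNr => le1 le2 le3.
rewrite -(ler_pM2r d0); move: le1 le2 le3.
move: (dotp G (y - z)) (dotp _ (y - z)) (enorm (y - z)) (enorm G).
by move=> a b c d; lra.
Qed.

(** The cubic remainder of [taylor_ge] is dominated by the quadratic term as long
    as |w - z| < 3 mu / (7 L). *)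
Lemma local_min_of_positive_definite (R : realType) k (L mu : R)
    (h : 'rV[R]_k -> R) (z : 'rV[R]_k) : lip_hess L h -> 0 < L -> 0 < mu ->
  grad h z = 0 -> (forall v, mu * enorm v ^+ 2 <= dotp (v *m hess h z) v) ->
  local_min h z.
Proof.
move=> H L0 mu0 gz pd; pose c := 3 * mu / (7 * L).
have c0 : 0 < c by rewrite divr_gt0 ?mulr_gt0.
have near_z : \forall w \near z, enorm (w - z) < c.
  have : enorm (w - z) @[w --> z] --> enorm (z - z).
    apply: (@continuous_comp _ _ _ (fun w : 'rV[R]_k => w - z) (@enorm R k)).
      apply: (@continuousD _ _ _ id (cst (- z))); first exact: cvg_id.
      exact: cst_continuous.
    exact: continuous_enorm.
  by rewrite subrr enorm0 => /cvgr_lt /(_ c c0).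
apply: filterS near_z => w.
rewrite /c ltr_pdivlMr ?mulr_gt0 // => close.
have := taylor_ge z (w - z) H; have := pd (w - z).
rewrite [z + _]addrC subrK gz dotp0l; set d := enorm (w - z) in close *.
have := ler_wpM2r (sqr_ge0 d) (ltW close).
by move: (dotp _ _) (h w) (h z) => p q r; lra.
Qed.

(** * Short steps along the iteration *)

Lemma newton_descent (R : realType) k L (h : 'rV[R]_k -> R) (y0 : 'rV[R]_k) y
    a b : lip_hess L h -> 0 < L -> cubic_newton h L y0 y -> (a <= b)%N ->
  \sum_(a <= j < b) L / 12 * enorm (y j.+1 - y j) ^+ 3 <= h (y a) - h (y b).
Proof.
move=> H L0 [_ newton] ab.
rewrite -opprB -(telescope_sumr (fun j => h (y j)) ab) -sumrN.
apply: ler_sum => j _.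
by have := cubic_descent H L0 (newton j); rewrite opprB [y j + _]addrC subrK.
Qed.

Lemma newton_monotone (R : realType) k L (h : 'rV[R]_k -> R)
    (y0 : 'rV[R]_k) y a :
  lip_hess L h -> 0 < L -> cubic_newton h L y0 y -> h (y a) <= h y0.
Proof.
move=> H L0 newton; have [<- _] := newton; rewrite -subr_ge0.
apply: le_trans (newton_descent H L0 newton (leq0n a)).
apply: sumr_ge0 => j _.
by rewrite mulr_ge0 ?exprn_ge0 ?enorm_ge0 // divr_ge0 // ltW.
Qed.

(** Pigeonhole on the telescoped decrease of h: otherwise each of the b - a steps
    would decrease h by more than Delta / (b - a). *)
Lemma newton_short_step (R : realType) k L (h : 'rV[R]_k -> R) (y0 : 'rV[R]_k) y
    a b Delta : lip_hess L h -> 0 < L -> cubic_newton h L y0 y -> (a < b)%N ->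
  h (y a) - h (y b) <= Delta ->
  exists2 j, (a <= j < b)%N &
    (b - a)%:R * (L * enorm (y j.+1 - y j) ^+ 3) <= 12 * Delta.
Proof.
move=> H L0 newton ab hD; apply: contrapT => none.
have := newton_descent H L0 newton (ltnW ab); apply/negP; rewrite -ltNge.
apply: le_lt_trans hD _.
have N0 : (0 < (b - a)%:R :> R) by rewrite ltr0n subn_gt0.
have -> : Delta = \sum_(a <= j < b) Delta / (b - a)%:R.
  by rewrite sumr_const_nat -[RHS]mulr_natr divfK // gt_eqF.
rewrite !big_nat; apply: ltr_sum; last first.
  move=> j jab; rewrite ltr_pdivrMr // ltNge; apply/negP => le.
  by apply: none; exists j => //; move: le; lra.
by apply/hasP; exists a; rewrite ?mem_index_iota ?leqnn.
Qed.

(** The reason for the constant 256/9: with p = sqrt L and q = sqrt e the two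
    hypotheses give (p r)^3 <= (12 * 9 / 256) q^3, and 12 * 9 / 256 = (3/4)^3. *)
Lemma gradient_bound_of_steps (R : realType) (L e Delta r N : R) :
  0 < L -> 0 < e -> 0 <= r -> 0 < N -> N * (L * r ^+ 3) <= 12 * Delta ->
  256 * Delta * L `^ (1 / 2) / (9 * e `^ (3 / 2)) <= N ->
  L * r ^+ 2 <= 9 / 16 * e.
Proof.
move=> L0 e0 r0 N0 steps.
have -> : L `^ (1 / 2) = Num.sqrt L by rewrite mul1r powR12_sqrt // ltW.
have -> : e `^ (3 / 2) = Num.sqrt e ^+ 3.
  rewrite -powR12_sqrt ?ltW // -powR_mulrn ?powR_ge0 // -powRrM; congr (_ `^ _).
  by field.
have : 0 < Num.sqrt e by rewrite sqrtr_gt0.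
have : 0 < Num.sqrt L by rewrite sqrtr_gt0.
rewrite -{3}(sqr_sqrtr (ltW e0)) -{3}(sqr_sqrtr (ltW L0)).
move: steps; rewrite -{1}(sqr_sqrtr (ltW L0)).
move: (Num.sqrt L) (Num.sqrt e) => p q steps p0 q0.
rewrite ler_pdivrMr ?mulr_gt0 ?exprn_gt0 // => bound.
have cube : (p * r) ^+ 3 <= (3 / 4 * q) ^+ 3.
  rewrite -(ler_pM2l N0); have := ler_wpM2l (ltW p0) steps.
  by move: bound; lra.
rewrite ler_pXn2r ?nnegrE ?mulr_ge0 ?divr_ge0 ?(ltW p0) ?(ltW q0) // in cube.
have -> : p ^+ 2 * r ^+ 2 = (p * r) ^+ 2 by ring.
have -> : 9 / 16 * q ^+ 2 = (3 / 4 * q) ^+ 2 by field.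
by rewrite ler_pXn2r ?nnegrE ?mulr_ge0 ?divr_ge0 ?(ltW p0) ?(ltW q0).
Qed.

(** The reason for the constant 768: 12 / 768 = (1/4)^3. *)
Lemma step_bound_of_steps (R : realType) (L mu Delta r N : R) :
  0 < L -> 0 < mu -> 0 <= r -> 0 < N -> N * (L * r ^+ 3) <= 12 * Delta ->
  768 * Delta * L ^+ 2 / mu ^+ 3 <= N -> L * r <= mu / 4.
Proof.
move=> L0 mu0 r0 N0 steps.
rewrite ler_pdivrMr ?exprn_gt0 // => bound.
have cube : (L * r) ^+ 3 <= (mu / 4) ^+ 3.
  rewrite -(ler_pM2l N0); have := ler_wpM2l (ltW (exprn_gt0 2 L0)) steps.
  by move: bound; lra.
by rewrite ler_pXn2r ?nnegrE ?mulr_ge0 ?divr_ge0 ?(ltW L0) ?(ltW mu0) // in cube.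
Qed.

(** * The basin of a nondegenerate minimizer *)

(** The constants are those of the smallness reached after one short step:
    9/64 = (9/16)(1/4) comes from [gradient_bound_of_steps] with e at most
    mu^2/(4L), and 1/4 keeps the Hessian above (3/4) mu. *)
Definition in_basin (R : realType) k (L mu : R) (h : 'rV[R]_k -> R)
    (z y : 'rV[R]_k) : Prop :=
  L * enorm (y - z) <= mu / 4 /\ L * enorm (grad h y) <= 9 / 64 * mu ^+ 2.

(** The right-hand side of [grad_near_ge] is at least (7/8) mu |y - z| here. *)
Lemma in_basin_dist (R : realType) k (L mu : R) (h : 'rV[R]_k -> R)
    (z y : 'rV[R]_k) : lip_hess L h -> 0 < mu -> grad h z = 0 ->
  (forall v, mu * enorm v ^+ 2 <= dotp (v *m hess h z) v) ->
  in_basin L mu h z y -> enorm (y - z) <= 2 * enorm (grad h y) / mu.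
Proof.
move=> H mu0 gz pd [near_z _]; rewrite ler_pdivlMr //.
have := grad_near_ge y H gz pd; have := enorm_ge0 (y - z).
move: near_z; move: (enorm (y - z)) (enorm (grad h y)) => d g; nra.
Qed.

(** In the basin the Hessian is at least (3/4) mu, so stationarity gives
    (3/4) mu |s| <= |grad h(y)|, and the next gradient, at most L|s|^2, is
    quadratically small.  The step may first bring y + s to distance
    (7/16) mu/L from z; the small gradient then pulls the distance back below
    mu/(4L) through [grad_near_ge]. *)
Lemma basin_step (R : realType) k (L mu : R) (h : 'rV[R]_k -> R)
    (z y s : 'rV[R]_k) : lip_hess L h -> 0 < L -> 0 < mu -> grad h z = 0 ->
  (forall v, mu * enorm v ^+ 2 <= dotp (v *m hess h z) v) ->
  argmin setT (cubic_model h L y) s -> in_basin L mu h z y ->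
  in_basin L mu h z (y + s) /\ enorm (grad h (y + s)) <= enorm (grad h y) / 4.
Proof.
move=> H L0 mu0 gz pd smin [near_z small].
have r0 := enorm_ge0 s.
have short : 3 / 4 * mu * enorm s <= enorm (grad h y).
  have [->|s0] := eqVneq s 0; first by rewrite enorm0 mulr0 enorm_ge0.
  have rp : 0 < enorm s by rewrite enorm_gt0.
  rewrite -(ler_pM2r rp); have := hess_near_ge y s H pd.
  have : dotp (grad h y + s *m hess h y + (L / 2 * enorm s) *: s) s = 0.
    by rewrite (cubic_stationary H L0 smin) dotp0l.
  have := dotp_ge (grad h y) s; move: (grad h y) (hess h y) => G A.
  rewrite !(dotpDl, dotpZl) -sqr_enorm.
  have := ler_wpM2r (sqr_ge0 (enorm s)) near_z.
  have := mulr_ge0 (ltW L0) (exprn_ge0 3 r0).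
  move: (dotp G s) (dotp (s *m A) s) (enorm s) (enorm G) (enorm (y - z)).
  by move=> a b c d e; lra.
have quad := cubic_grad_le H L0 smin.
have g0 := enorm_ge0 (grad h y).
have contract : enorm (grad h (y + s)) <= enorm (grad h y) / 4.
  have sq : (3 / 4 * mu * enorm s) ^+ 2 <= enorm (grad h y) ^+ 2.
    by rewrite ler_pXn2r ?nnegrE ?mulr_ge0 ?divr_ge0 // ltW.
  rewrite -(ler_pM2l (exprn_gt0 2 mu0)).
  have := ler_wpM2l (sqr_ge0 mu) quad; have := ler_wpM2l (ltW L0) sq.
  have := ler_wpM2r g0 small.
  move: (enorm (grad h y)) (enorm (grad h (y + s))) (enorm s) => a b c; lra.
(* 9/256 is a quarter of the bound 9/64 on the previous gradient. *)
have small' : L * enorm (grad h (y + s)) <= 9 / 256 * mu ^+ 2.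
  have := ler_wpM2l (ltW L0) contract; move: small.
  by move: (enorm (grad h y)) (enorm (grad h (y + s))) => a b; lra.
have d1 : L * enorm (y + s - z) <= 7 / 16 * mu.
  have : enorm (y + s - z) <= enorm (y - z) + enorm s by rewrite addrAC enormD.
  move=> /(ler_wpM2l (ltW L0)) le; apply: le_trans le _.
  have : mu * (L * enorm s) <= mu * (3 / 16 * mu).
    have := ler_wpM2l (ltW L0) short; move: small.
    by move: (enorm (grad h y)) (enorm s) => a b; lra.
  rewrite ler_pM2l //; move: near_z; lra.
have d0 := enorm_ge0 (y + s - z).
have near' : L * enorm (y + s - z) <= mu / 4.
  rewrite -(ler_pM2l mu0).
  have := ler_wpM2l (ltW L0) (grad_near_ge (y + s) H gz pd).
  have := ler_wpM2r (mulr_ge0 (ltW L0) d0) d1.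
  have := sqr_ge0 mu.
  move: small'; move: (enorm (y + s - z)) (enorm (grad h (y + s))) => a b; lra.
split=> //; split=> //; apply: le_trans small' _.
by rewrite ler_pM2r ?exprn_gt0 //; lra.
Qed.

Lemma basin_iterates (R : realType) k (L mu : R) (h : 'rV[R]_k -> R)
    (y0 z : 'rV[R]_k) y i0 : lip_hess L h -> 0 < L -> 0 < mu -> grad h z = 0 ->
  (forall v, mu * enorm v ^+ 2 <= dotp (v *m hess h z) v) ->
  cubic_newton h L y0 y -> in_basin L mu h z (y i0) ->
  forall i, in_basin L mu h z (y (i0 + i)%N) /\
    enorm (grad h (y (i0 + i)%N)) <= enorm (grad h (y i0)) * 4^-1 ^+ i.
Proof.
move=> H L0 mu0 gz pd [_ newton] start; elim=> [|i [IH le]].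
  by rewrite addn0 expr0 mulr1.
have := basin_step H L0 mu0 gz pd (newton _) IH.
rewrite addnS [y _ + _]addrC subrK => -[inb le']; split=> //.
by apply: le_trans le' _; rewrite exprSr mulrA ler_wpM2r // invr_ge0.
Qed.

Lemma cvg_enorm_geometric (R : realType) k (u : nat -> 'rV[R]_k) (z : 'rV[R]_k)
    (C : R) i0 :
  (forall i, enorm (u (i0 + i)%N - z) <= C * 4^-1 ^+ i) -> u @ \oo --> z.
Proof.
move=> le; rewrite -(cvg_shiftn i0); apply/cvgrPdist_lt => e e0.
have q1 : `|4^-1 : R| < 1 by rewrite ger0_norm ?invr_ge0 //; lra.
have /cvgrPdist_lt to0 := cvg_geometric C q1.
have [n _ small] := to0 e e0.
exists n => // i /= ni; rewrite distrC addnC.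
apply: le_lt_trans (norm_le_enorm _) _; apply: le_lt_trans (le i) _.
have := small i ni; rewrite sub0r normrN /geometric /=.
by apply: le_lt_trans; exact: ler_norm.
Qed.

Lemma basin_cvg (R : realType) k (L mu : R) (h : 'rV[R]_k -> R)
    (y0 z : 'rV[R]_k) y i : lip_hess L h -> 0 < L -> 0 < mu -> grad h z = 0 ->
  (forall v, mu * enorm v ^+ 2 <= dotp (v *m hess h z) v) ->
  cubic_newton h L y0 y -> in_basin L mu h z (y i) -> y @ \oo --> z.
Proof.
move=> H L0 mu0 gz pd newton start.
apply: (@cvg_enorm_geometric _ _ _ _ (2 * enorm (grad h (y i)) / mu) i) => j.
have [inb le] := basin_iterates H L0 mu0 gz pd newton start j.
apply: le_trans (in_basin_dist H mu0 gz pd inb) _.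
by rewrite -!mulrA ler_pM2l // [mu^-1 * _]mulrC mulrA ler_pM2r ?invr_gt0.
Qed.

(** One step among the first N is short enough for both conclusions.  Then the
    gradient is below alpha, which provides a critical point z at distance at
    most (9/16) mu/L, and the Hessian at z is at least
    -(3/8) mu - (9/16) mu = -(15/16) mu.  The strict inequality 15/16 < 1 is what
    the spectral gap needs to conclude that z is a minimizer. *)
Lemma basin_entry (R : realType) k (L mu alpha Delta : R) (h : 'rV[R]_k -> R)
    (y0 : 'rV[R]_k) y N : lip_hess L h -> 0 < L -> 0 < mu -> 0 < alpha ->
  cubic_newton h L y0 y -> h (y 0) - h (y N) <= Delta ->
  (forall i, enorm (grad h (y i)) < alpha ->
    exists z, [/\ grad h z = 0, L * enorm (y i - z) <= 9 / 16 * mu &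
      forall lambda : R, eigenvalue (hess h z) lambda -> mu <= `|lambda|]) ->
  (0 < N)%N ->
  256 * Delta * L `^ (1 / 2) /
    (9 * Num.min alpha (mu ^+ 2 / (4 * L)) `^ (3 / 2)) <= N%:R ->
  768 * Delta * L ^+ 2 / mu ^+ 3 <= N%:R ->
  exists z i, [/\ grad h z = 0,
    forall v, mu * enorm v ^+ 2 <= dotp (v *m hess h z) v,
    (i <= N)%N & in_basin L mu h z (y i)].
Proof.
move=> H L0 mu0 alpha0 newton hD near_crit N0 N1 N2.
have [j /andP[_ jN]] := newton_short_step H L0 newton N0 hD.
rewrite subn0; set s := _ - _ => short.
have NR : (0 < N%:R :> R) by rewrite ltr0n.
have r0 := enorm_ge0 s.
set e := Num.min _ _ in N1.
have e_alpha : e <= alpha by rewrite ge_min lexx.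
have e_mu : e <= mu ^+ 2 / (4 * L) by rewrite ge_min lexx orbT.
have e0 : 0 < e by rewrite lt_min alpha0 divr_gt0 ?exprn_gt0 ?mulr_gt0.
have bound1 := gradient_bound_of_steps L0 e0 r0 NR short N1.
have bound2 := step_bound_of_steps L0 mu0 r0 NR short N2.
have smin := (proj2 newton) j.
have yE : y j + s = y j.+1 by rewrite /s addrC subrK.
have := cubic_grad_le H L0 smin; rewrite -/s yE => small.
have {small} := le_trans small bound1 => small.
have [|z [gz dist eig]] := near_crit j.+1; first lra.
have low v : - (15 / 16 * mu * enorm v ^+ 2) <= dotp (v *m hess h z) v.
  have := cubic_hess_next_ge v H L0 smin; rewrite -/s yE => low.
  have := lip_hessP (y j.+1) z v v H.
  have := ler_wpM2r (sqr_ge0 (enorm v)) dist.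
  have := ler_wpM2r (sqr_ge0 (enorm v)) bound2.
  move: low; move: (hess h) => A.
  move: (dotp (v *m A z) v) (dotp (v *m A (y j.+1)) v) (enorm v) (enorm s).
  by move: (enorm (y j.+1 - z)) => a b c d f; lra.
have pd := positive_definite_of_eigenvalues
  (fun u w => hess_sym z u w H) eig _ low.
have {}pd : forall v, mu * enorm v ^+ 2 <= dotp (v *m hess h z) v.
  by apply: pd; lra.
exists z, j.+1; split=> //.
have small' : L * enorm (grad h (y j.+1)) <= 9 / 64 * mu ^+ 2.
  have le : L * e <= mu ^+ 2 / 4.
    move: e_mu; rewrite !ler_pdivlMr ?mulr_gt0 //; lra.
  have := ler_wpM2l (ltW L0) small; lra.
split=> //.
rewrite -(ler_pM2l mu0).
have := ler_wpM2l (ltW L0) (grad_near_ge (y j.+1) H gz pd).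
have := ler_wpM2r (mulr_ge0 (ltW L0) (enorm_ge0 (y j.+1 - z))) dist.
have := sqr_ge0 mu.
move: small'; move: (enorm (y j.+1 - z)) (enorm (grad h _)) => a b; lra.
Qed.

(** * Accumulation points, finite minimization and distances *)

Lemma cluster_cvg (R : realType) k (u : nat -> 'rV[R]_k) (z : 'rV[R]_k) :
  u @ \oo --> z -> cluster (u @ \oo) = [set z].
Proof.
move=> uz; apply/seteqP; split=> [w /(cvg_cluster uz) zw|_ -> A B uA zB].
  by apply/esym; exact: norm_hausdorff zw.
exact: (filter_ex (filterI uA (uz _ zB))).
Qed.

Lemma argmin_exists (R : realType) (A : set nat) (h : nat -> R) (K : nat) :
  A K -> (forall i, A i -> (i <= K)%N) -> exists i, argmin A h i.
Proof.
move=> AK Ale; pose P (i : 'I_K.+1) := `[< A i >].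
have PK : P ord_max by apply/asboolP.
case: (arg_minP (fun i : 'I_K.+1 => h i) PK) => i /asboolP Ai imin.
exists i; split=> // j Aj; have jK : (j < K.+1)%N by rewrite ltnS Ale.
by apply: (imin (Ordinal jK)); apply/asboolP.
Qed.

(** The infimum that defines the distance need not be attained a priori, hence the
    larger radius. *)
Lemma crit_nbh_near (R : realType) n m (Y' : set 'rV[R]_m)
    (g : 'rV[R]_n -> 'rV[R]_m -> R) x r r' z : r < r' ->
  crit_nbh Y' g x r z -> exists2 c, crit Y' g x c & enorm (z - c) < r'.
Proof.
move=> rr' zr; have : (edistance z (crit Y' g x) < r'%:E)%E.
  by apply: le_lt_trans zr _; rewrite lte_fin.
by move=> /ereal_inf_lt[_ [c cc <-]]; rewrite lte_fin; exists c.
Qed.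

(** * Convergence and complexity *)

Theorem lemma4p4 (R : realType) (n m : nat)
  (X : set 'rV[R]_n) (f g : 'rV[R]_n -> 'rV[R]_m -> R) (y0 : 'rV[R]_m)
  (Lg Lgg glow Lf g0bar : R) (Y Y' : set 'rV[R]_m)
  (mu : R -> R) (alpha : R -> R -> R)
  (y : 'rV[R]_n -> nat -> 'rV[R]_m) (K0 : nat)
  (f_cont : {within cylinder X, continuous (joint f)})
  (g_C2 : C2_on (cylinder X) (joint g))
  (X_convex : convex_set X)
  (X_compact : compact X)
  (g_smooth : lipschitz_for (@enorm R (n + m)) Lg (cylinder X)
                (grad (joint g)))
  (Lgg_gt0 : 0 < Lgg)
  (gyy_lip : lipschitz_for (@opnorm R m m) Lgg (cylinder X)
               (joint (fun x => hess (g x))))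
  (g_low : forall x z, X x -> glow <= g x z)
  (Y_compact : compact Y)
  (sub_compact : forall x, X x -> compact (sublevel g y0 x))
  (sub_Y : forall x, X x -> sublevel g y0 x `<=` Y)
  (f_lip : lipschitz_for (fun t : R => `|t|) Lf
             [set z : 'rV[R]_(n + m) |
               X (lsubmx z) /\ sublevel g y0 (lsubmx z) (rsubmx z)]
             (joint f))
  (g0_bound : forall x, X x -> g x y0 <= g0bar)
  (Y'_compact : compact Y')
  (Y_int : Y `<=` interior Y')
  (mu_gt0 : forall delta, 0 < delta -> 0 < mu delta)
  (mu_eig : forall delta, 0 < delta ->
     forall x, X x -> ~ not_morse_nbh X g delta x ->
     forall z, Y' z -> grad (g x) z = 0 ->
     forall lambda : R, eigenvalue (hess (g x) z) lambda ->
     mu delta <= `|lambda|)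
  (alpha_gt0 : forall delta r, 0 < delta -> 0 < r -> 0 < alpha delta r)
  (alpha_grad : forall delta r, 0 < delta -> 0 < r ->
     forall x, X x -> ~ not_morse_nbh X g delta x ->
     forall z, Y z -> ~ crit_nbh Y' g x r z ->
     alpha delta r <= enorm (grad (g x) z))
  (y_newton : forall x, X x -> cubic_newton (g x) Lgg y0 (y x))
  (y_descent : forall x k, X x -> (K0 <= k)%N -> g x (y x k) <= g x y0)
  (y_accum : forall x, X x ->
     cluster (y x @ \oo) `<=` [set z | grad (g x) z = 0])
  (delta : R) (delta_gt0 : 0 < delta)
  (x : 'rV[R]_n) (Xx : X x) (x_far : ~ not_morse_nbh X g delta x) :
  exists ycd : 'rV[R]_m,
    [/\ argmin (cluster (y x @ \oo)) (f x) ycd,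
        y x @ \oo --> ycd,
        local_min (g x) ycd &
        forall (rho : R) (K : nat),
        let K1 :=
          Num.max
            (256 * (g0bar - glow) * Lgg `^ (1 / 2) /
             (9 * Num.min (alpha delta (mu delta / (2 * Lgg)))
                          (mu delta ^+ 2 / (4 * Lgg)) `^ (3 / 2)))
            (768 * (g0bar - glow) * Lgg ^+ 2 / mu delta ^+ 3) in
        let K2 :=
          256 * (g0bar - glow) * Lgg `^ (1 / 2) /
          (9 * (mu delta * rho / 2) `^ (3 / 2)) in
        let range := [set k : nat | K1 < k%:R /\ (k <= K)%N] in
        let gnorm := fun k : nat => enorm (grad (g x) (y x k)) in
        0 < rho -> (K0 <= K)%N -> K1 + K2 < K%:R ->
        (exists k0, argmin range gnorm k0) /\
        forall k0, argmin range gnorm k0 ->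
          gnorm k0 <= mu delta * rho /\ enorm (y x k0 - ycd) <= rho].
Proof.
have H := slice_lip_hess Xx g_C2 gyy_lip.
have newton := y_newton x Xx.
set L := Lgg in H newton *.
have L0 : 0 < L := Lgg_gt0.
have mu0 := mu_gt0 _ delta_gt0.
have r0 : 0 < mu delta / (2 * L) by rewrite divr_gt0 ?mulr_gt0.
have alpha0 := alpha_gt0 _ _ delta_gt0 r0.
have y_sub k : sublevel g y0 x (y x k) by exact: newton_monotone H L0 newton.
have drop a b : g x (y x a) - g x (y x b) <= g0bar - glow.
  have := y_sub a; rewrite /sublevel /=.
  have := g0_bound x Xx; have := g_low x (y x b) Xx; lra.
have Delta0 : 0 <= g0bar - glow by have := drop 0%N 0%N; rewrite subrr.
have near_crit i :
    enorm (grad (g x) (y x i)) < alpha delta (mu delta / (2 * L)) ->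
    exists z, [/\ grad (g x) z = 0, L * enorm (y x i - z) <= 9 / 16 * mu delta &
      forall lambda : R, eigenvalue (hess (g x) z) lambda ->
        mu delta <= `|lambda|].
  move=> small.
  have near_i : crit_nbh Y' g x (mu delta / (2 * L)) (y x i).
    apply: contrapT => far.
    have Yi := sub_Y x Xx _ (y_sub i).
    have := alpha_grad _ _ delta_gt0 r0 x Xx x_far _ Yi far.
    by rewrite leNgt small.
  (* 9/16 exceeds the 1/2 of the hypothesis and still leaves
     3/8 + 9/16 < 1 for the curvature estimate of basin_entry. *)
  have [|z [Y'z gz] close] :=
    @crit_nbh_near _ _ _ _ _ _ _ (9 / 16 * mu delta / L) _ _ near_i.
    by rewrite ltr_pdivrMr ?mulr_gt0 // mulrA mulrAC divfK ?gt_eqF //; lra.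
  exists z; split=> //; last exact: mu_eig delta_gt0 x Xx x_far z Y'z gz.
  by rewrite mulrC -ler_pdivlMr // ltW.
set K1 := Num.max _ _.
have K1_ge0 : 0 <= K1.
  rewrite /K1 le_max; apply/orP; right; apply: divr_ge0.
    apply: mulr_ge0; last exact: sqr_ge0.
    by apply: mulr_ge0 Delta0; exact: ler0n.
  by apply: exprn_ge0; exact: ltW.
have entry (k : nat) : K1 < k%:R -> exists z i, [/\ grad (g x) z = 0,
    forall v, mu delta * enorm v ^+ 2 <= dotp (v *m hess (g x) z) v,
    (i <= k)%N & in_basin L (mu delta) (g x) z (y x i)].
  move=> K1k.
  apply: (basin_entry H L0 mu0 alpha0 newton (drop 0%N k) near_crit).
  - by rewrite -(ltr_nat R); apply: le_lt_trans K1k.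
  - by apply: le_trans (ltW K1k); rewrite /K1 le_max lexx.
  - by apply: le_trans (ltW K1k); rewrite /K1 le_max lexx orbT.
have [|ycd [i0 [gz pd _ start0]]] := entry (Num.truncn K1).+1.
  by have /andP[] := Num.Theory.truncn_itv K1_ge0.
have ycvg := basin_cvg H L0 mu0 gz pd newton start0.
have dist k : K1 < k%:R ->
    enorm (y x k - ycd) <= 2 * enorm (grad (g x) (y x k)) / mu delta.
  move=> /entry[z [i [gz' pd' ik start]]].
  (* The critical point z depends on k a priori; it is the limit of the
     sequence for each k. *)
  have -> : ycd = z.
    apply: (@cvg_unique _ (@norm_hausdorff _ _) (y x @ \oo)) => //.
    exact: basin_cvg H L0 mu0 gz' pd' newton start.
  apply: (in_basin_dist H mu0 gz' pd').
  have [] := basin_iterates H L0 mu0 gz' pd' newton start (k - i).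
  by rewrite subnKC.
exists ycd; split=> //.
- by rewrite (cluster_cvg ycvg); split=> // _ ->.
- exact: local_min_of_positive_definite H L0 mu0 gz pd.
move=> rho K /=; rewrite -/L -/K1; set K2 := (X in K1 + X) => rho0 _ KK.
have e0 : 0 < mu delta * rho / 2 by rewrite divr_gt0 ?mulr_gt0.
have K2_ge0 : 0 <= K2.
  apply: divr_ge0; apply: mulr_ge0; try exact: powR_ge0; try exact: ler0n.
  by apply: mulr_ge0 Delta0; exact: ler0n.
split.
  apply: (@argmin_exists _ _ _ K) => [|i []//].
  by split=> //; apply: le_lt_trans KK; rewrite lerDl.
move=> k0 [[K1k0 _] k0min].
have small : enorm (grad (g x) (y x k0)) <= 9 / 16 * (mu delta * rho / 2).
  (* The steps a, ..., K - 1, with a the integer part of K1, are those that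
     end at an index of the range; there are K - a >= K - K1 > K2 of them. *)
  have /andP[aK1 K1a] := Num.Theory.truncn_itv K1_ge0.
  set a := Num.truncn K1 in aK1 K1a.
  have aK : (a < K)%N.
    by rewrite -(ltr_nat R); apply: le_lt_trans aK1 _;
    apply: le_lt_trans KK; rewrite lerDl.
  have [j /andP[aj jK]] := newton_short_step H L0 newton aK (drop a K).
  set s := _ - _ => short.
  have N0 : (0 < (K - a)%:R :> R) by rewrite ltr0n subn_gt0.
  have N2 : K2 <= (K - a)%:R by rewrite natrB ?(ltnW aK) //; lra.
  have bound := gradient_bound_of_steps L0 e0 (enorm_ge0 s) N0 short N2.
  apply: le_trans bound.
  have := cubic_grad_le H L0 (proj2 newton j).
  rewrite -/s [y x j + s]addrC subrK; apply: le_trans.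
  apply: k0min; split=> //; apply: lt_le_trans K1a _.
  by rewrite ler_nat ltnS.
split; first by lra.
apply: le_trans (dist _ K1k0) _; rewrite ler_pdivrMr //.
by move: small; rewrite [rho * _]mulrC; lra.
Qed.
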